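(* Let $A$ be a real affine space of finite dimension $n$ and $m\in\mathrm{Met}(A)$ a metric with hessian principal component $g$. The Cayley–Menger product $\mathrm{CM}_m$ has the following properties. 1. On the subspace $\mathrm{Aff}_0(\mathrm{Quad}_mA)$ there holds $\mathrm d\circ\mathrm{CM}_m=-g\circ\mathrm d_m$ (where $\mathrm{CM}_m$ maps $\mathrm{Aff}_0(\mathrm{Quad}_mA)$ into $\mathrm{Aff}(A)\subset\widehat{\mathrm{Quad}_mA}$ and $\mathrm d:\mathrm{Aff}(A)\to\vec A^*$ is the linear part). 2. For any affine referential $(R_0,\dots,R_n)$ of $A$, $\mathrm{CM}_m$ transforms the basis $(v_{R_0},\dots,v_{R_n},v_m)$ of $\mathrm{Aff}(\mathrm{Quad}_mA)$ into the elements $(\delta^m_{R_0},\dots,\delta^m_{R_n},u_m)$ of $\widehat{\mathrm{Quad}_mA}$ (which form a basis of this space if $m$ is non-degenerate). 3. For any affine referentials $\mathcal R=(R_0,\dots,R_n)$ and $\mathcal S=(S_0,\dots,S_n)$ of $A$, the matrix representing $\mathrm{CM}_m:\mathrm{Aff}(\mathrm{Quad}_mA)\to\widehat{\mathrm{Quad}_mA}$, using $(v_{R_0},\dots,v_{R_n},v_m)$ as basis on the first space and $(v_{S_0},\dots,v_{S_n},v_m)$ as linear coordinates on the second (rows indexed by the first family, columns by the second, the entries being the values $\mathrm{CM}_m(\cdot,\cdot)$), is $$\begin{bmatrix}\frac12D^{\mathcal R\mathcal S}&\mathbf 1^t\\ \mathbf 1&0\end{bmatrix},\qquad D^{\mathcal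 R\mathcal S}_{ij}=g(\overrightarrow{R_iS_j},\overrightarrow{R_iS_j}).$$ 4. The Gram matrix of $\mathrm{CM}_m$ in the basis $(v_{R_0},\dots,v_{R_n},v_m)$ is $$\begin{bmatrix}\frac12D^{\mathcal R}&\mathbf 1^t\\ \mathbf 1&0\end{bmatrix},\qquad D^{\mathcal R}_{ij}=g(\overrightarrow{R_iR_j},\overrightarrow{R_iR_j}).$$ 5. If $P,Q\in A$ have barycentric coordinate column vectors $p,q$ in the referential $\mathcal R$, then their squared pseudodistance $d^2(P,Q)=g(\overrightarrow{PQ},\overrightarrow{PQ})$ is $$d^2(P,Q)=-\tfrac12(q-p)^t\,D^{\mathcal R}\,(q-p).$$
   Context: All spaces are real and finite-dimensional. For an affine space $A$ with director vector space $\vec A$: $\mathrm{Aff}(A)$ is the vector space of affine functions $A\to\mathbb R$, $u$ the constant function $1$; $\vec A^{*}=\mathrm{Aff}(A)/\langle u\rangle$ is the dual of $\vec A$, and $\mathrm df\in\vec A^*$ is the linear part of $f$. The linear hull is $\widehat A=(\mathrm{Aff}(A))^*$; $z_P\in\widehat A$ is evaluation at $P$; $A$ is identified with $\{z:\langle z,u\rangle=1\}$ and $\vec A$ with $\{z:\langle z,u\rangle=0\}$, $\overrightarrow{PQ}=z_Q-z_P$. An affine referential is a sequence of $n+1$ affinely independent points; $P=\sum p_iR_i$ with $\sum p_i=1$ has barycentric coordinate vector $p=[p_0\dots p_n]^t$. $\mathbf 1=[1\dots1]$ is the row vector with $n+1$ entries. A function $\delta:A\to\mathbb R$ is quadratic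 if $\delta(\alpha P+\beta Q)=\alpha(\alpha-\beta)\delta(P)+\beta(\beta-\alpha)\delta(Q)+4\alpha\beta\,\delta(\frac{P+Q}2)$ whenever $\alpha+\beta=1$; $\mathrm{Quad}(A)$ is the vector space of these. Each $\delta\in\mathrm{Quad}(A)$ has a symmetric bilinear form $\mathrm{Hess}\,\delta$ on $\vec A$ (hessian principal component), characterized by $\frac12(\delta(Q)+\delta(2P-Q))-\delta(P)=\frac12\mathrm{Hess}\,\delta(\overrightarrow{PQ},\overrightarrow{PQ})$ for all $P,Q$. $\mathrm{Met}(A)=\mathrm{Quad}(A)/\mathrm{Aff}(A)$ is the space of metrics; for $m\in\mathrm{Met}(A)$, $\mathrm{Quad}_mA\subset\mathrm{Quad}(A)$ is the class $m$, an affine space with director space $\mathrm{Aff}(A)$; its elements share the same hessian principal component $g$ (that of $m$). $m$ is non-degenerate if $g$ has trivial nullspace. $\delta^m_P(Q)=\frac12g(\overrightarrow{PQ},\overrightarrow{PQ})$ defines $\delta^m_P\in\mathrm{Quad}_mA$. $\mathrm{Aff}(\mathrm{Quad}_mA)$ is the vector space of affine functionals $\mathrm{Quad}_mA\to\mathbb R$; its dual is $\widehat{\mathrm{Quad}_mA}$, containing $\mathrm{Quad}_mA$ by evaluation. $v_P(\delta)=\delta(P)$ for $P\in A$, $v_m(\delta)=1$. $\mathrm d_m:\mathrm{Aff}(\mathrm{Quad}_mA)\to\widehat A$, $\langle\mathrm d_m\bar v,s\rangle=\bar v(\delta+s)-\bar v(\delta)$; its dual $\mathrm d_m^*:\mathrm{Aff}(A)\hookrightarrow\widehat{\mathrm{Quad}_mA}$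 is injective with image the annihilator of $v_m$, and is used to regard $\mathrm{Aff}(A)\subset\widehat{\mathrm{Quad}_mA}$; $u_m=\mathrm d_m^*u$. $\mathrm{Aff}_0(\mathrm{Quad}_mA)=\{\bar v:\langle u_m,\bar v\rangle=0\}$; $\mathrm d_m$ maps it into $\vec A$. A bilinear form $\Phi$ on $V$ is also viewed as the linear map $V\to V^*$, $v\mapsto\Phi(v,\cdot)$. The Cayley–Menger product $\mathrm{CM}_m$ is the unique symmetric bilinear form on $\mathrm{Aff}(\mathrm{Quad}_mA)$ with (1) $\mathrm{CM}_m(v_1,v_2)=-g(\mathrm d_mv_1,\mathrm d_mv_2)$ for $v_1,v_2\in\mathrm{Aff}_0(\mathrm{Quad}_mA)$ and (2) $\mathrm{CM}_m(v_P)=\delta^m_P$ for all $P\in A$ (for $m\ne0$, (2) may equivalently be replaced by $\mathrm{CM}_m(v_P,v_P)=0$ for all $P\in A$). *)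

(* Defs.v *)
From HB Require Import structures.
From mathcomp Require Import all_boot all_order all_algebra.
From mathcomp Require Import ring lra.
From mathcomp Require Import boolp functions reals.

Set Implicit Arguments.
Unset Strict Implicit.
Unset Printing Implicit Defensive.

Import Order.TTheory GRing.Theory Num.Theory.
Local Open Scope ring_scope.

Lemma linfunE (R : realType) (U W : vectType R) (f : U -> W) :
  linear f -> linfun f =1 f.
Proof.
move=> h; pose l : {linear U -> W} :=
  HB.pack f (GRing.isLinear.Build R U W _ _ h).
exact: (lfunE l).
Qed.

(* [vec P Q] is the vector from [P] to [Q]; together with the inhabitation,
   the three laws say that [V] acts simply transitively on the points. *)
Record affineSpace (R : realType) (V : vectType R) := AffineSpace {
  point :> Type;
  shift : point -> V -> point;
  vec : point -> point -> V;
  point_inhabited : inhabited point;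
  shiftD : forall P x y, shift P (x + y) = shift (shift P x) y;
  shift_vec : forall P Q, shift P (vec P Q) = Q;
  vec_shift : forall P x, vec P (shift P x) = x }.

Arguments shift {R V a} P x.
Arguments vec {R V a} P Q.

Lemma inhabitedE (T : Type) : inhabited T -> exists _ : T, True.
Proof. by case=> x; exists x. Qed.

Definition origin (R : realType) (V : vectType R) (A : affineSpace V) : A :=
  projT1 (cid (inhabitedE (point_inhabited A))).
Arguments origin {R V} A.

Section AffineTheory.
Variables (R : realType) (V : vectType R) (A : affineSpace V).
Implicit Types (P Q S : A) (x y : V).

Lemma vecPP P : vec P P = 0.
Proof.
set x := vec P P.
have hx : shift P x = P by exact: shift_vec.
have h : vec P (shift P (x + x)) = x by rewrite shiftD !hx.
by move: h; rewrite vec_shift => /(congr1 (fun z => z - x)); rewrite addrK subrr.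
Qed.

Lemma shift0 P : shift P 0 = P.
Proof. by rewrite -{2}(shift_vec P P) vecPP. Qed.

Lemma vecD P Q S : vec P Q + vec Q S = vec P S.
Proof. by rewrite -[LHS](vec_shift P) shiftD !shift_vec. Qed.

Lemma vecN P Q : vec Q P = - vec P Q.
Proof. by apply/eqP; rewrite -addr_eq0 vecD vecPP. Qed.

Lemma vec_shiftr P Q x : vec P (shift Q x) = vec P Q + x.
Proof. by rewrite -(vecD P Q) vec_shift. Qed.

End AffineTheory.

Definition is_affine (R : realType) (V : vectType R) (A : affineSpace V)
    (f : A -> R^o) : Prop :=
  exists phi : 'Hom(V, R^o), forall P x, f (shift P x) = f P + phi x.

Definition affine_pred (R : realType) (V : vectType R) (A : affineSpace V) :
  {pred A -> R^o} := fun f => `[< is_affine f >].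

Section AffinePred.
Variables (R : realType) (V : vectType R) (A : affineSpace V).

Lemma affine_pred_submod : submod_closed (@affine_pred R V A).
Proof.
split.
  by apply/asboolP; exists 0 => P x; rewrite lfunE /= addr0.
move=> a f g /asboolP [p hp] /asboolP [q hq]; apply/asboolP.
exists (a *: p + q) => P x.
rewrite !fctE hp hq !lfunE /= lfunE /= scalerDr addrACA.
by [].
Qed.

HB.instance Definition _ :=
  GRing.isSubmodClosed.Build R (A -> R^o) (@affine_pred R V A) affine_pred_submod.

End AffinePred.

Record Aff (R : realType) (V : vectType R) (A : affineSpace V) := MkAff {
  aff_fun :> A -> R^o;
  _ : aff_fun \in @affine_pred R V A }.

Section AffLmod.
Variables (R : realType) (V : vectType R) (A : affineSpace V).

HB.instance Definition _ := [isSub of Aff A for @aff_fun R V A].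
HB.instance Definition _ := [Choice of Aff A by <:].
HB.instance Definition _ := [SubChoice_isSubZmodule of Aff A by <:].
HB.instance Definition _ := [SubZmodule_isSubLmodule of Aff A by <:].

Implicit Types (f g : Aff A).

Lemma affP f g : f =1 g -> f = g.
Proof. by move=> h; apply: val_inj; apply: funext => x; exact: h. Qed.

Lemma affD f g P : (f + g) P = f P + g P. Proof. by []. Qed.
Lemma affB f g P : (f - g) P = f P - g P. Proof. by []. Qed.
Lemma affZ a f P : (a *: f) P = a * f P. Proof. by []. Qed.

Lemma aff_affine f : is_affine f.
Proof. by apply/asboolP; exact: (valP f). Qed.

(* The linear part does not depend on the base point, see [lin_partE]. *)
Definition lin_part f : 'Hom(V, R^o) :=
  linfun (fun x => f (shift (origin A) x) - f (origin A) : R^o).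

Lemma lin_partE f P x : f (shift P x) = f P + lin_part f x.
Proof.
have [p hp] := aff_affine f.
suff -> : lin_part f = p by [].
rewrite /lin_part -[p]fun_of_lfunK; congr linfun; apply: funext => y.
by rewrite hp addrC addKr.
Qed.

Lemma lin_part_vec f P Q : f Q = f P + lin_part f (vec P Q).
Proof. by rewrite -lin_partE shift_vec. Qed.

Lemma lin_part_uniq f (p : 'Hom(V, R^o)) P :
  (forall x, f (shift P x) = f P + p x) -> lin_part f = p.
Proof.
move=> h; apply/lfunP => x; apply: (addrI (f P)).
by rewrite -lin_partE h.
Qed.

Lemma lin_part_is_linear : linear lin_part.
Proof.
move=> a f g; apply: (@lin_part_uniq _ _ (origin A)) => x.
rewrite affD affZ !lin_partE !lfunE /= lfunE /= mulrDr addrACA.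
by [].
Qed.
HB.instance Definition _ :=
  GRing.isSemilinear.Build R (Aff A) 'Hom(V, R^o) _ lin_part
    (GRing.semilinear_linear lin_part_is_linear).

Lemma mkaff_subproof (p : 'Hom(V, R^o)) (c : R) :
  (fun Q => c + p (vec (origin A) Q) : R^o) \in @affine_pred R V A.
Proof.
by apply/asboolP; exists p => P x; rewrite vec_shiftr linearD addrA.
Qed.
Definition mkaff p c : Aff A := MkAff (mkaff_subproof p c).

Lemma mkaffE p c P : mkaff p c P = c + p (vec (origin A) P).
Proof. by []. Qed.

Lemma lin_part_mkaff p c : lin_part (mkaff p c) = p.
Proof.
apply: (@lin_part_uniq _ _ (origin A)) => x.
by rewrite !mkaffE vec_shift vecPP linear0 addr0.
Qed.

Lemma mkaff_lin_part f : mkaff (lin_part f) (f (origin A)) = f.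
Proof. by apply: affP => P; rewrite mkaffE -lin_part_vec. Qed.

Fact aff_vect_iso :
  Vector.axiom (1 + \dim {:'Hom(V, R^o)}) (Aff A).
Proof.
pose e := vbasis {: 'Hom(V, R^o)}.
exists (fun f => row_mx (f (origin A))%:M (\row_i coord e i (lin_part f))).
  move=> k f g; rewrite scale_row_mx add_row_mx; congr row_mx.
    by apply/rowP => i; rewrite ord1 !mxE /= !mulr1n.
  by apply/rowP => i; rewrite !mxE !linearP.
exists (fun r => mkaff (\sum_i rsubmx r 0 i *: e`_i) (lsubmx r 0 0)).
  move=> f; rewrite row_mxKl row_mxKr mxE mulr1n.
  rewrite -[RHS]mkaff_lin_part; congr mkaff.
  rewrite [RHS](coord_vbasis (memvf _)).
  by apply: eq_bigr => i _; rewrite mxE.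
move=> r; rewrite -[RHS]hsubmxK; congr row_mx.
  by apply/rowP => i; rewrite ord1 mkaffE vecPP linear0 addr0 [in LHS]mxE mulr1n.
apply/rowP => i; rewrite [in LHS]mxE lin_part_mkaff coord_sum_free //.
exact: basis_free (vbasisP _).
Qed.

HB.instance Definition _ := Lmodule_hasFinDim.Build R (Aff A) aff_vect_iso.

Definition aff1 : Aff A := mkaff 0 1.

Lemma aff1E P : aff1 P = 1.
Proof. by rewrite mkaffE lfunE addr0. Qed.

Lemma lin_part_aff1 : lin_part aff1 = 0.
Proof. exact: lin_part_mkaff. Qed.

Lemma lin_part_eq0 f : lin_part f = 0 -> f = f (origin A) *: aff1.
Proof.
move=> h; apply: affP => P; rewrite affZ aff1E mulr1.
by rewrite (lin_part_vec _ (origin A)) h lfunE addr0.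
Qed.

(* The linear hull of [A] is ['Hom(Aff A, R^o)], and [hull_pt] embeds [A] in it. *)

Definition hull_pt (P : A) : 'Hom(Aff A, R^o) := linfun (fun f : Aff A => f P).

Lemma hull_ptE P f : hull_pt P f = f P.
Proof. exact: (@linfunE R (Aff A) R^o (fun f => f P)). Qed.

(* [hull_vec] is the inclusion of the director space in the linear hull, dual to
   [lin_part]: it sends [vec P Q] to [hull_pt Q - hull_pt P]. *)
Definition hull_vec_fun (x : V) : 'Hom(Aff A, R^o) :=
  linfun (fun f => lin_part f x).

Lemma hull_vec_funE x f : hull_vec_fun x f = lin_part f x.
Proof.
apply: (@linfunE R (Aff A) R^o (fun f => lin_part f x)).
by move=> a g h; rewrite linearP !lfunE /= lfunE.
Qed.

Lemma hull_vec_is_linear : linear hull_vec_fun.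
Proof.
move=> a x y; apply/lfunP => f; rewrite !lfunE /= lfunE /= !hull_vec_funE.
by rewrite linearP.
Qed.
HB.instance Definition _ :=
  GRing.isSemilinear.Build R V 'Hom(Aff A, R^o) _ hull_vec_fun
    (GRing.semilinear_linear hull_vec_is_linear).

Definition hull_vec : 'Hom(V, 'Hom(Aff A, R^o)) := linfun hull_vec_fun.

Lemma hull_vecE x f : hull_vec x f = lin_part f x.
Proof. by rewrite lfunE /= hull_vec_funE. Qed.

Lemma hull_vec_vec P Q : hull_vec (vec P Q) = hull_pt Q - hull_pt P.
Proof.
apply/lfunP => f; rewrite hull_vecE !lfunE /= lfunE /= !hull_ptE.
by rewrite (lin_part_vec f P Q) addrC addKr.
Qed.

(* the inverse identification; meaningful on the annihilator of [aff1] *)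
Definition vec_of_hull (z : 'Hom(Aff A, R^o)) : V := (hull_vec^-1)%VF z.

End AffLmod.

Arguments aff1 {R V} A.
Arguments hull_vec {R V} A.
Arguments lin_part {R V A} f.

Section HullVec.
Variables (R : realType) (V : vectType R) (A : affineSpace V).
Implicit Types (f : Aff A) (z : 'Hom(Aff A, R^o)).

Let cf i : 'Hom(V, R^o) := linfun (coord (vbasis {: V}) i : V -> R^o).

Let cfE i x : cf i x = coord (vbasis {: V}) i x.
Proof.
by apply: (@linfunE R V R^o (coord (vbasis {: V}) i)) => a y z; rewrite linearP.
Qed.

Lemma hull_vec1 x : hull_vec A x (aff1 A) = 0.
Proof. by rewrite hull_vecE lin_part_aff1 lfunE. Qed.

Lemma aff_sumE I (r : seq I) (F : I -> Aff A) P :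
  (\sum_(i <- r) F i) P = \sum_(i <- r) F i P.
Proof. by elim/big_rec2: _ => // i y f _ <-. Qed.

Lemma hull_vec_onto z : z (aff1 A) = 0 -> exists x, z = hull_vec A x.
Proof.
move=> hz; exists (\sum_(i < \dim {: V}) z (mkaff A (cf i) 0) *: (vbasis {: V})`_i).
apply/lfunP => f; rewrite hull_vecE linear_sum /=.
have {1}-> : f = f (origin A) *: aff1 A
             + \sum_(i < \dim {: V}) lin_part f (vbasis {: V})`_i *: mkaff A (cf i) 0.
  apply: affP => P; rewrite affD affZ aff1E mulr1 aff_sumE.
  rewrite (lin_part_vec f (origin A) P); congr (_ + _).
  rewrite {1}(coord_vbasis (memvf (vec (origin A) P))) linear_sum.
  by apply: eq_bigr => i _; rewrite linearZ affZ mkaffE add0r cfE mulrC.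
rewrite linearD linearZ /= hz scaler0 add0r linear_sum.
by apply: eq_bigr => i _; rewrite !linearZ; exact: mulrC.
Qed.

Lemma vec_of_hullK z : z (aff1 A) = 0 -> hull_vec A (vec_of_hull z) = z.
Proof.
by move=> /hull_vec_onto [x ->]; rewrite /vec_of_hull limg_lfunVK // memv_img ?memvf.
Qed.

Lemma hull_vec_inj : injective (hull_vec A).
Proof.
move=> x y h; rewrite (coord_vbasis (memvf x)) (coord_vbasis (memvf y)).
apply: eq_bigr => i _; congr (_ *: _).
move/lfunP/(_ (mkaff A (cf i) 0)): h.
by rewrite !hull_vecE lin_part_mkaff !cfE.
Qed.

Lemma hull_vecK x : vec_of_hull (hull_vec A x) = x.
Proof.
by apply: hull_vec_inj; rewrite vec_of_hullK // hull_vec1.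
Qed.

End HullVec.

(* [comb P b Q] is the affine combination [(1 - b) P + b Q], see [hull_comb]. *)
Definition comb (R : realType) (V : vectType R) (A : affineSpace V)
  (P : A) (b : R) (Q : A) : A := shift P (b *: vec P Q).

Lemma hull_comb (R : realType) (V : vectType R) (A : affineSpace V)
    (a b : R) (P Q : A) :
  a + b = 1 -> hull_pt (comb P b Q) = a *: hull_pt P + b *: hull_pt Q.
Proof.
move=> hab; have -> : a = 1 - b by rewrite -hab addrK.
apply/lfunP => f; rewrite !lfunE /= !lfunE /= !hull_ptE /comb lin_partE.
rewrite (lin_part_vec f P Q) linearZ /= scalerBl scale1r scalerDr.
by rewrite addrA addrNK.
Qed.

Definition is_quadratic (R : realType) (V : vectType R) (A : affineSpace V)
    (delta : A -> R^o) : Prop :=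
  forall (a b : R) (P Q : A), a + b = 1 ->
    delta (comb P b Q) =
      a * (a - b) * delta P + b * (b - a) * delta Q
        + 4 * a * b * delta (comb P 2^-1 Q).

(* A metric is an element of Quad(A)/Aff(A), given as a coset. *)
Record metric (R : realType) (V : vectType R) (A : affineSpace V) := Metric {
  quad_class :> (A -> R^o) -> Prop;
  quad_classP : exists2 delta0, is_quadratic delta0 &
    forall delta, quad_class delta <-> is_affine (delta - delta0) }.

Definition symmetric_form (R : realType) (W : vectType R)
    (B : 'Hom(W, 'Hom(W, R^o))) : Prop :=
  forall x y, B x y = B y x.

(* Here [comb P (- 1) Q] is the point [2 P - Q]. *)
Definition is_hess (R : realType) (V : vectType R) (A : affineSpace V)
    (delta : A -> R^o) (g : 'Hom(V, 'Hom(V, R^o))) : Prop :=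
  symmetric_form g /\
  forall P Q : A, 2^-1 * (delta Q + delta (comb P (- 1) Q)) - delta P =
    2^-1 * g (vec P Q) (vec P Q).

Lemma mkform (R : realType) (W : vectType R) (B : W -> W -> R) :
  (forall a x y z, B (a *: x + y) z = a * B x z + B y z) ->
  (forall a x y z, B z (a *: x + y) = a * B z x + B z y) ->
  exists Phi : 'Hom(W, 'Hom(W, R^o)), forall x y, Phi x y = B x y.
Proof.
move=> hl hr.
pose F x : 'Hom(W, R^o) := linfun (B x : W -> R^o).
have FE x y : F x y = B x y.
  by apply: (@linfunE R W R^o (B x)) => a u v; exact: hr.
have hF : linear F.
  by move=> a x y; apply/lfunP => z; rewrite !lfunE /= lfunE /= !FE hl.
by exists (linfun F) => x y; rewrite linfunE.
Qed.

Lemma formDl (R : realType) (W : vectType R) (B : 'Hom(W, 'Hom(W, R^o))) x y z :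
  B (x + y) z = B x z + B y z.
Proof. by rewrite linearD lfunE. Qed.

Lemma formZl (R : realType) (W : vectType R) (B : 'Hom(W, 'Hom(W, R^o))) a x z :
  B (a *: x) z = a * B x z.
Proof. by rewrite linearZ lfunE. Qed.

Lemma formDr (R : realType) (W : vectType R) (B : 'Hom(W, 'Hom(W, R^o))) x y z :
  B x (y + z) = B x y + B x z.
Proof. exact: linearD. Qed.

Lemma formZr (R : realType) (W : vectType R) (B : 'Hom(W, 'Hom(W, R^o))) a x z :
  B x (a *: z) = a * B x z.
Proof. exact: linearZ. Qed.

Section Hess.
Variables (R : realType) (V : vectType R) (A : affineSpace V).

Section HessExists.
Variables (delta : A -> R^o) (hq : is_quadratic delta).
Let f (x : V) : R := delta (shift (origin A) x).

Let f_line (s : R) p x :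
  f (p + s *: x) = (1 - s) * (1 - s - s) * f p + s * (s - (1 - s)) * f (p + x)
     + 4 * (1 - s) * s * f (p + 2^-1 *: x).
Proof.
rewrite /f !shiftD; set P := shift _ p.
have := @hq (1 - s) s P (shift P x) (subrK _ _).
by rewrite /comb vec_shift.
Qed.

Let third p x : f (p + x *+ 3) = f p - 3 * f (p + x) + 3 * f (p + x *+ 2).
Proof.
have := f_line (3 / 2) p (x *+ 2).
rewrite -![x *+ 2](scaler_nat 2 x) !scalerA.
rewrite divfK ?pnatr_eq0 // mulVf ?pnatr_eq0 // scale1r (scaler_nat 3 x) => ->.
by field.
Qed.

Let second p x y :
  f (p + x *+ 2 + y) - 2 * f (p + x + y) + f (p + y) =
  f (p + x *+ 2) - 2 * f (p + x) + f p.
Proof.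
rewrite -(subrK y p); move: (p - y) => {}p.
pose G i j : R := f (p + x *+ i + y *+ j).
have Ex k i j : G (k + i)%N j = f (p + x *+ i + y *+ j + x *+ k).
  by rewrite /G mulrnDr (addrC (x *+ k)) addrA -!addrA (addrC (x *+ k)).
have Ey k i j : G i (k + j)%N = f (p + x *+ i + y *+ j + y *+ k).
  by rewrite /G mulrnDr (addrC (y *+ k)) addrA.
have Ed k i j : G (k + i)%N (k + j)%N = f (p + x *+ i + y *+ j + (x + y) *+ k).
  rewrite Ey mulrnDl addrA; congr (f (_ + _)).
  by rewrite mulrnDr (addrC (x *+ k)) addrA -!addrA (addrC (x *+ k)).
have hx i j : G (3 + i)%N j = G i j - 3 * G (1 + i)%N j + 3 * G (2 + i)%N j.
  by rewrite !Ex third.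
have hy i j : G i (3 + j)%N = G i j - 3 * G i (1 + j)%N + 3 * G i (2 + j)%N.
  by rewrite !Ey third.
have hd i j : G (3 + i)%N (3 + j)%N = G i j - 3 * G (1 + i)%N (1 + j)%N
    + 3 * G (2 + i)%N (2 + j)%N.
  by rewrite !Ed third.
have ha : G 3%N 0%N = G 0%N 3%N - 3 * G 1%N 2%N + 3 * G 2%N 1%N.
  have Ea k l : G k l = f (p + y *+ (k + l)%N + (x - y) *+ k).
    by rewrite /G mulrnBl mulrnDr !addrA addrAC (addrAC _ (y *+ k)) addrK addrAC.
  by rewrite !Ea third !addn0 !add0n mulr0n addr0.
suff : G 2%N 2%N - 2 * G 1%N 2%N + G 0%N 2%N
     = G 2%N 1%N - 2 * G 1%N 1%N + G 0%N 1%N.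
  by rewrite /G !mulr0n !mulr1n !addr0 !mulr2n !addrA -!(addrAC _ y).
have := (hx 0 0)%N; have := (hx 0 1)%N; have := (hx 0 2)%N; have := (hx 0 3)%N.
have := (hy 0 0)%N; have := (hy 1 0)%N; have := (hy 2 0)%N; have := (hy 3 0)%N.
have := (hd 0 0)%N; move: ha.
rewrite !addn0 /=.
lra.
Qed.

Let B p x y : R := f (p + x + y) - f (p + x) - f (p + y) + f p.

Let B_half p x y : B p (2^-1 *: x) y = 2^-1 * B p x y.
Proof.
have := second p (2^-1 *: x) y.
rewrite -(scaler_nat 2) scalerA mulfV ?pnatr_eq0 // scale1r /B => h.
lra.
Qed.

Let BZ p s x y : B p (s *: x) y = s * B p x y.
Proof.
have := B_half p x y; rewrite /B !(addrAC _ _ y) !(f_line s).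
move: (f (p + y)) (f (p + y + x)) (f (p + y + 2^-1 *: x)) => c1 c2 c3.
move: (f p) (f (p + x)) (f (p + 2^-1 *: x)) => c4 c5 c6 h.
have -> : c3 = c6 + c1 - c4 + 2^-1 * (c2 - c5 - c1 + c4) by lra.
by field.
Qed.

Let T x y z : R := f (x + y + z) - f (x + y) - f (x + z) - f (y + z)
  + f x + f y + f z - f 0.

Let TE x y z : T x y z = B y x z - B 0 x z.
Proof. by rewrite /T /B !add0r (addrC y x); ring. Qed.

Let T12 x y z : T x y z = T y x z.
Proof. by rewrite /T (addrC y x); ring. Qed.

Let T13 x y z : T x y z = T z y x.
Proof.
by rewrite /T (addrC (z + y)) (addrC z y) addrA (addrC z x) (addrC y x); ring.
Qed.

Let TZ s x y z : T (s *: x) y z = s * T x y z.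
Proof. by rewrite !TE !BZ; ring. Qed.

Let TZ3 s x y z : T (s *: x) (s *: y) (s *: z) = s ^+ 3 * T x y z.
Proof. by rewrite TZ T12 TZ T13 TZ -T13 -T12 !mulrA !exprS expr0 mulr1 mulrA. Qed.

Let T_eq0 x y z : T x y z = 0.
Proof.
have e k : T (x *+ k) (y *+ k) (z *+ k) = k%:R ^+ 3 * T x y z.
  by rewrite -!(scaler_nat k) TZ3.
have th w : f (w *+ 3) = f 0 - 3 * f w + 3 * f (w *+ 2).
  by have := third 0 w; rewrite !add0r.
have := e 3%N; have := e 2%N; rewrite {1 3}/T -!mulrnDl !th.
set t := T x y z; have : t = T x y z by [].
rewrite /T; lra.
Qed.

Lemma hess_exists : exists g, is_hess delta g.
Proof.
have BD x y z : B 0 (x + y) z = B 0 x z + B 0 y z.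
  by have := T_eq0 x y z; rewrite /T /B !add0r; lra.
have Bsym x y : B 0 x y = B 0 y x.
  by rewrite /B !add0r (addrC y x); lra.
have [g gE] : exists g : 'Hom(V, 'Hom(V, R^o)), forall x y, g x y = B 0 x y.
  apply: mkform => a x y z; first by rewrite BD BZ.
  by rewrite !(Bsym z) BD BZ.
exists g; split=> [x y|P Q]; first by rewrite !gE Bsym.
pose p := vec (origin A) P; pose x := vec P Q.
have -> : delta Q = f (p + x) by rewrite /f shiftD !shift_vec.
have -> : delta (comb P (-1) Q) = f (p - x).
  by rewrite /f shiftD shift_vec /comb scaleN1r.
have -> : delta P = f p by rewrite /f shift_vec.
rewrite -/x gE.
have e1 : B 0 p (- x) = - B 0 p x by rewrite !(Bsym p) -scaleN1r BZ mulN1r.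
have e2 : B 0 x (- x) = - B 0 x x by rewrite (Bsym x) -scaleN1r BZ mulN1r.
move: e1 e2; rewrite /B !add0r subrr; lra.
Qed.

End HessExists.

Lemma hess_aff (delta delta0 : A -> R^o) g :
  is_affine (delta - delta0) -> is_hess delta0 g -> is_hess delta g.
Proof.
move=> [p hp] [gs h]; split=> // P Q.
have e x : delta (shift P x) = delta0 (shift P x) + delta P - delta0 P + p x.
  by have := hp P x; rewrite !fctE /= => e; lra.
rewrite -h -{1}(shift_vec P Q) /comb !e !shift_vec linearZ /=.
rewrite (_ : -1 *: p (vec P Q) = - p (vec P Q)); last exact: scaleN1r.
lra.
Qed.

Lemma hess_uniq (delta : A -> R^o) g g' :
  is_hess delta g -> is_hess delta g' -> g = g'.
Proof.
move=> [gs h] [gs' h'].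
have e x : g x x = g' x x.
  have := h (origin A) (shift (origin A) x); rewrite h' vec_shift; lra.
apply/lfunP => x; apply/lfunP => y.
have eD (h0 : 'Hom(V, 'Hom(V, R^o))) : symmetric_form h0 ->
    h0 (x + y) (x + y) = h0 x x + h0 y y + 2 * h0 x y.
  by move=> hs; rewrite formDl !formDr (hs y x); ring.
by have := e (x + y); rewrite !eD // !e; lra.
Qed.

Lemma metric_hess_exists (m : metric A) :
  exists g, forall delta, m delta -> is_hess delta g.
Proof.
have [delta0 /hess_exists [g hg] hm] := quad_classP m.
by exists g => delta /hm h; apply: hess_aff hg.
Qed.

Definition hess (m : metric A) : 'Hom(V, 'Hom(V, R^o)) :=
  projT1 (cid (metric_hess_exists m)).

Lemma hessP (m : metric A) (delta : A -> R^o) : m delta -> is_hess delta (hess m).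
Proof. exact: (projT2 (cid (metric_hess_exists m))). Qed.

End Hess.

Section MetricClass.
Variables (R : realType) (V : vectType R) (A : affineSpace V) (m : metric A).

Lemma class_shift (delta : A -> R^o) (s : Aff A) :
  m delta -> m (delta + s : A -> R^o).
Proof.
have [delta0 _ hm] := quad_classP m.
move=> /hm [p hp]; apply/hm; have [q hq] := aff_affine s.
exists (p + q) => P x; have := hp P x; have := hq P x.
by rewrite !fctE /= add_lfunE => -> e; rewrite addrAC e; ring.
Qed.

Lemma class_sub (delta delta' : A -> R^o) :
  m delta -> m delta' -> (delta' - delta : A -> R^o) \in @affine_pred R V A.
Proof.
have [delta0 _ hm] := quad_classP m.
move=> /hm [p hp] /hm [q hq]; apply/asboolP; exists (q - p) => P x.
have := hp P x; have := hq P x; rewrite !fctE /= add_lfunE opp_lfunE.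
by move=> e e'; lra.
Qed.

Lemma class_inhabited : inhabited {delta : A -> R^o | m delta}.
Proof.
have [delta0 _ hm] := quad_classP m.
suff h : m delta0 by constructor; exists delta0.
by apply/hm; exists 0 => P x; rewrite !fctE /= !subrr zero_lfunE addr0.
Qed.

Lemma class_eq (d d' : {delta : A -> R^o | m delta}) :
  sval d =1 sval d' -> d = d'.
Proof.
case: d d' => [d h] [d' h'] /= e.
have {}e : d = d' by exact: funext.
by case: _ / e h' => h'; congr exist; exact: Prop_irrelevance.
Qed.

Definition class_shift_fun (d : {delta : A -> R^o | m delta}) (s : Aff A) :
  {delta : A -> R^o | m delta} :=
  exist _ (sval d + s : A -> R^o) (class_shift s (svalP d)).

Definition class_vec_fun (d d' : {delta : A -> R^o | m delta}) : Aff A :=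
  MkAff (class_sub (svalP d) (svalP d')).

Lemma class_shiftD d s t :
  class_shift_fun d (s + t) = class_shift_fun (class_shift_fun d s) t.
Proof. by apply: class_eq => P /=; rewrite !fctE /= addrA. Qed.

Lemma class_shift_vec d d' : class_shift_fun d (class_vec_fun d d') = d'.
Proof. by apply: class_eq => P /=; rewrite !fctE /= addrC subrK. Qed.

Lemma class_vec_shift d s : class_vec_fun d (class_shift_fun d s) = s.
Proof. by apply: affP => P /=; rewrite !fctE /= addrC addKr. Qed.

Definition QuadM : affineSpace (Aff A) :=
  AffineSpace class_inhabited class_shiftD class_shift_vec class_vec_shift.

(* [evalM P] is the affine functional v_P, evaluation at [P]. *)
Lemma evalM_subproof (P : A) :
  (fun d : QuadM => sval d P : R^o) \in @affine_pred R _ QuadM.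
Proof. by apply/asboolP; exists (hull_pt P) => d s; rewrite hull_ptE. Qed.

Definition evalM (P : A) : Aff QuadM := MkAff (evalM_subproof P).

Lemma evalME P (d : QuadM) : evalM P d = sval d P. Proof. by []. Qed.

Lemma lin_part_evalM P : lin_part (evalM P) = hull_pt P.
Proof.
by apply: (@lin_part_uniq _ _ _ _ _ (origin QuadM)) => s; rewrite hull_ptE.
Qed.

Definition v_m : Aff QuadM := aff1 QuadM.

(* [lin_partE] gives [v (shift d s) = v d + d_m v s].  The transpose [d_m_dual]
   of [d_m] embeds [Aff A] in the linear hull of [QuadM]. *)
Definition d_m (v : Aff QuadM) : 'Hom(Aff A, R^o) := lin_part v.

Definition d_m_dual : 'Hom(Aff A, 'Hom(Aff QuadM, R^o)) := hull_vec QuadM.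

Lemma d_m_dualE f v : d_m_dual f v = d_m v f.
Proof. exact: hull_vecE. Qed.

Definition u_m : 'Hom(Aff QuadM, R^o) := d_m_dual (aff1 A).

Definition in_Aff0 (v : Aff QuadM) : Prop := u_m v = 0.

(* [d_m] as a map into the director space of [A]; meaningful on [in_Aff0] *)
Definition d_m_vec (v : Aff QuadM) : V := vec_of_hull (d_m v).

Lemma d_m_vecK v : in_Aff0 v -> hull_vec A (d_m_vec v) = d_m v.
Proof. by rewrite /in_Aff0 /u_m d_m_dualE => h; rewrite vec_of_hullK. Qed.

Definition sqdist (P Q : A) : R := hess m (vec P Q) (vec P Q).

Lemma affine_of_comb (psi : A -> R^o) :
  (forall a b P Q, a + b = 1 -> psi (comb P b Q) = a * psi P + b * psi Q) ->
  is_affine psi.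
Proof.
move=> h; pose O := origin A; pose phi x : R^o := psi (shift O x) - psi O.
have phiZ b x : phi (b *: x) = b * phi x.
  have := h (1 - b) b O (shift O x) (subrK _ _).
  by rewrite /comb vec_shift /phi => ->; ring.
have phiD x y : phi (x + y) = phi x + phi y.
  have e : 2^-1 + 2^-1 = 1 :> R by field.
  have := h _ _ (shift O (2 *: x)) (shift O (2 *: y)) e.
  have -> : comb (shift O (2 *: x)) 2^-1 (shift O (2 *: y)) = shift O (x + y).
    rewrite /comb -shiftD vec_shiftr (vecN O) vec_shift; congr shift.
    rewrite addrC scalerDr scalerN !scalerA mulVf ?pnatr_eq0 // !scale1r.
    by rewrite scaler_nat mulr2n addrC addrA addrK.
  have := phiZ 2 x; have := phiZ 2 y; rewrite /phi => e1 e2 e3; lra.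
exists (linfun phi) => P x; rewrite linfunE => [|a u v]; last first.
  by rewrite phiD phiZ.
have := phiD (vec O P) x; rewrite /phi shiftD !shift_vec => e; lra.
Qed.

(* [deltaM P] is delta^m_P as an element of the class [m]. *)
Lemma deltaM_subproof (P : A) : m (fun Q => 2^-1 * sqdist P Q : R^o).
Proof.
have [delta0 hq hm] := quad_classP m.
have [gs hg] : is_hess delta0 (hess m).
  apply: hessP; apply/hm; exists 0 => Q x.
  by rewrite !fctE /= !subrr zero_lfunE addr0.
apply/hm; apply: affine_of_comb => a b Q S hab.
rewrite !fctE /= (hq _ _ _ _ hab).
set M := comb Q 2^-1 S.
have MS : vec M S = 2^-1 *: vec Q S.
  rewrite -(vecD M Q S) (vecN Q M) vec_shift addrC.
  rewrite -{1}[vec Q S]scale1r -scalerBl; congr (_ *: _); by field.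
have := hg M S.
have -> : comb M (-1) S = Q.
  rewrite /comb MS scaleN1r /M /comb -shiftD subrr; exact: shift0.
rewrite MS formZl formZr /sqdist.
have -> : vec P (comb Q b S) = vec P Q + b *: vec Q S by rewrite vec_shiftr.
rewrite -(vecD P Q S) !formDl !formDr !formZl !formZr (gs (vec Q S) (vec P Q)).
have -> : a = 1 - b by rewrite -hab addrK.
move: (hess m _ _) (hess m _ _) (hess m _ _) => g1 g2 g3.
move: (delta0 Q) (delta0 S) (delta0 M) => c1 c2 c3 e.
have -> : c3 = 2^-1 * (c2 + c1) - 2^-1 * (2^-1 * (2^-1 * g3)) by rewrite -e; ring.
by field.
Qed.

Definition deltaM (P : A) : QuadM := exist _ _ (deltaM_subproof P).

Definition is_CM (Phi : 'Hom(Aff QuadM, 'Hom(Aff QuadM, R^o))) : Prop :=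
  [/\ symmetric_form Phi,
      forall v1 v2, in_Aff0 v1 -> in_Aff0 v2 ->
        Phi v1 v2 = - hess m (d_m_vec v1) (d_m_vec v2)
    & forall P, Phi (evalM P) = hull_pt (deltaM P)].

Let g := hess m.
Let O := origin A.
Let w (v : Aff QuadM) : R := u_m v.
Let x (v : Aff QuadM) : V := vec_of_hull (d_m v - w v *: hull_pt O).
Let c (v : Aff QuadM) : R := v (deltaM O).

Let w_lin a v v' : w (a *: v + v') = a * w v + w v'.
Proof. by rewrite /w linearP. Qed.

Let c_lin a v v' : c (a *: v + v') = a * c v + c v'.
Proof. by []. Qed.

Let x_lin a v v' : x (a *: v + v') = a *: x v + x v'.
Proof.
rewrite /x /vec_of_hull -linearP; congr ((_ ^-1)%VF _).
by rewrite w_lin /d_m linearP scalerDl -scalerA scalerBr opprD addrACA.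
Qed.

Let d_mE v : d_m v = w v *: hull_pt O + hull_vec A (x v).
Proof.
have h : (d_m v - w v *: hull_pt O) (aff1 A) = 0.
  rewrite add_lfunE opp_lfunE scale_lfunE hull_ptE aff1E.
  have -> : d_m v (aff1 A) = w v by rewrite -d_m_dualE.
  by rewrite [_ *: _]mulr1 subrr.
by rewrite /x (vec_of_hullK h) [RHS]addrC subrK.
Qed.

Let gsym y z : g y z = g z y.
Proof. by have [h _] := hessP (deltaM_subproof O). Qed.

Lemma CM_exists : exists Phi, is_CM Phi.
Proof.
pose B v v' : R := w v * c v' + w v' * c v - g (x v) (x v').
have Bsym v v' : B v v' = B v' v by rewrite /B gsym; ring.
have Blin a v1 v2 v : B (a *: v1 + v2) v = a * B v1 v + B v2 v.
  by rewrite /B w_lin c_lin x_lin formDl formZl; ring.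
have [Phi PhiE] := mkform Blin (fun a v1 v2 v =>
  etrans (Bsym _ _) (etrans (Blin a v1 v2 v)
    (congr2 (fun s t => a * s + t) (Bsym _ _) (Bsym _ _)))).
exists Phi; split=> [v v'|v v' h h'|P].
- by rewrite !PhiE Bsym.
- by rewrite PhiE /B /x /w h h' !scale0r !subr0 !mul0r !add0r.
apply/lfunP => v; rewrite PhiE hull_ptE (lin_part_vec v (deltaM O)).
rewrite -/(c v) -/(d_m v) d_mE add_lfunE scale_lfunE hull_vecE hull_ptE.
have wP : w (evalM P) = 1 by rewrite /w /u_m d_m_dualE /d_m lin_part_evalM hull_ptE aff1E.
pose y := vec O P.
have xP : x (evalM P) = y.
  by rewrite /x wP scale1r /d_m lin_part_evalM -hull_vec_vec hull_vecK.
have cP : c (evalM P) = 2^-1 * g y y by [].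
have -> : vec (deltaM O) (deltaM P) = mkaff A (- g y) (2^-1 * g y y).
  apply: affP => Q; rewrite mkaffE opp_lfunE /=.
  rewrite !fctE /= /sqdist -(vecD P O Q) (vecN O P) -/y -/g -scaleN1r.
  rewrite !formDl !formDr !formZl !formZr (gsym (vec O Q) y).
  by move: (g y y) (g y _) (g _ _) => g1 g2 g3; field.
rewrite mkaffE lin_part_mkaff vecPP linear0 addr0 opp_lfunE /B wP xP cP.
by rewrite [_ *: _]mulrC; ring.
Qed.

Lemma CM_uniq Phi Psi : is_CM Phi -> is_CM Psi -> Phi = Psi.
Proof.
move=> [s1 a1 b1] [s2 a2 b2]; pose v0 := evalM O.
have w0 : w v0 = 1 by rewrite /w /u_m d_m_dualE /d_m lin_part_evalM hull_ptE aff1E.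
have dec v : exists2 v1, v = w v *: v0 + v1 & in_Aff0 v1.
  exists (v - w v *: v0); first by rewrite addrC subrK.
  by rewrite /in_Aff0 linearB linearZ /= -/(w v0) w0 [_ *: _]mulr1 subrr.
have e P v : Phi (evalM P) v = Psi (evalM P) v by rewrite b1 b2.
apply/lfunP => v; apply/lfunP => v'.
have [v1 -> h1] := dec v; have [v2 -> h2] := dec v'.
rewrite !formDl !formDr !formZl !formZr !(s1 v1 v0) !(s2 v1 v0).
by rewrite (a1 _ _ h1 h2) (a2 _ _ h1 h2) /v0 !e.
Qed.

Definition CM : 'Hom(Aff QuadM, 'Hom(Aff QuadM, R^o)) :=
  projT1 (cid CM_exists).

Lemma CMP : is_CM CM.
Proof. exact: (projT2 (cid CM_exists)). Qed.

End MetricClass.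

Definition nondegenerate_metric (R : realType) (V : vectType R) (A : affineSpace V)
  (m : metric A) : Prop := lker (hess m) = 0%VS.

Section Referentials.
Variables (R : realType) (V : vectType R) (A : affineSpace V) (n : nat).

(* To be used with [\dim {: V} = n]. *)
Definition referential (S : 'I_n.+1 -> A) : Prop :=
  free [seq vec (S ord0) (S (lift ord0 i)) | i : 'I_n].

(* [P = \sum_i p_i S_i] as an equality in the linear hull *)
Definition bary_coord (S : 'I_n.+1 -> A) (P : A) (p : 'cV[R]_n.+1) : Prop :=
  \sum_i p i 0 = 1 /\ hull_pt P = \sum_i p i 0 *: hull_pt (S i).

Variable m : metric A.

Definition v_fam (S : 'I_n.+1 -> A) (i : 'I_(n.+1 + 1)) : Aff (QuadM m) :=
  match fintype.split i with inl k => evalM m (S k) | inr _ => v_m m end.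

Definition delta_fam (S : 'I_n.+1 -> A) (i : 'I_(n.+1 + 1)) :
    'Hom(Aff (QuadM m), R^o) :=
  match fintype.split i with inl k => hull_pt (deltaM m (S k)) | inr _ => u_m m end.

Definition D_mx (S T : 'I_n.+1 -> A) : 'M[R]_n.+1 :=
  \matrix_(i, j) sqdist m (S i) (T j).

End Referentials.

Definition is_basis (R : realType) (W : vectType R) k (e : 'I_k -> W) : bool :=
  basis_of {: W} [seq e i | i : 'I_k].

(* Also the matrix of [Phi : W -> W^*] with respect to the basis [e] of [W] and
   the linear coordinates [e'] on [W^*]. *)
Definition form_mx (R : realType) (W : vectType R) k l
    (Phi : 'Hom(W, 'Hom(W, R^o))) (e : 'I_k -> W) (e' : 'I_l -> W) :
  'M[R]_(k, l) := \matrix_(i, j) Phi (e i) (e' j).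

(* Main.v *)
Require Import Defs.
From mathcomp Require Import all_boot all_order all_algebra.
From mathcomp Require Import reals.

Set Implicit Arguments.
Unset Strict Implicit.
Unset Printing Implicit Defensive.

Import Order.TTheory GRing.Theory Num.Theory.
Local Open Scope ring_scope.

(** Everything follows from computing [CM m] on the functionals [evalM m P] and
    [v_m m], which span [Aff (QuadM m)].  The values on the [evalM m P] are part
    of the characterization of [CM m]; the remaining one is [CM_v_m]: the
    constant functional is sent to [u_m m].  To see it, split a functional as a
    multiple of some [evalM m P] plus an element of Aff_0: on the first summand
    symmetry reduces the claim to the value of [v_m m] at a quadratic function,
    which is 1, and on the second both sides vanish, since the constant [v_m m]
    has zero differential.  The matrix formulas are then read off entry by entry.

    By [CM_v_m] and symmetry, [CM m v (v_m m)] is [u_m m v].  So for [v] in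
    Aff_0 the form [CM m v] kills the constants, hence comes from an affine
    function [f] on [A].  Pairing it with [evalM m Q - evalM m P], whose
    differential is the vector from [P] to [Q], gives the increment of [f] on one
    side and minus the hessian form on the other; this is [CM_Aff0_affine].

    The family [v_fam m S] is free because differentiation kills [v_m m] and
    turns the other members into points of the linear hull of [A], where affine
    independence of [S] is linear independence; its size is the dimension of
    [Aff (QuadM m)].  When the metric is non-degenerate [CM m] is injective
    ([CM_inj]) between spaces of the same dimension, so it carries this basis to
    a basis.

    Finally, if [p] and [q] are barycentric coordinates of [P] and [Q], the
    functional with coefficients [q - p] on the [evalM m (S i)] lies in Aff_0 and
    has the vector from [P] to [Q] as differential.  Computing its [CM m]-square
    through the hessian and through the Gram matrix gives the squared distance
    formula ([sqdist_bary]). *)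

Lemma free_famP (R : realType) (W : vectType R) k (e : 'I_k -> W) :
  reflect (forall c : 'I_k -> R, \sum_i c i *: e i = 0 -> forall i, c i = 0)
          (free [seq e i | i : 'I_k]).
Proof.
have nthE (i : 'I_k) : [seq e i | i : 'I_k]`_i = e i.
  by rewrite (nth_map i) ?size_enum_ord // nth_ord_enum.
apply: (iffP (@freeP _ _ _ [tuple e i | i < k])) => h c hc; apply: h;
  rewrite -[RHS]hc; apply: eq_bigr => i _; by rewrite /= -[map _ _]/(image _ _) nthE.
Qed.

Lemma is_basis_free (R : realType) (W : vectType R) k (e : 'I_k -> W) :
  \dim {: W} = k -> free [seq e i | i : 'I_k] -> is_basis e.
Proof.
by move=> dW fe; rewrite /is_basis basisEfree fe subvf size_image card_ord dW /=.
Qed.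

Section AffineLemmas.
Variables (R : realType) (V : vectType R) (A : affineSpace V).

Lemma dim_dual (W : vectType R) : \dim {: 'Hom(W, R^o)} = \dim {: W}.
Proof. by rewrite !dimvf; exact: muln1. Qed.

Lemma dim_Aff : \dim {: Aff A} = (\dim {: V}).+1.
Proof. by rewrite [LHS]dimvf -dim_dual. Qed.

Lemma aff1_neq0 : aff1 A != 0.
Proof.
apply/eqP => /(congr1 (fun f : Aff A => f (origin A))); rewrite aff1E.
by move=> e; have := oner_neq0 R; rewrite e eqxx.
Qed.

Lemma hull_pt_aff1 (P : A) : hull_pt P (aff1 A) = 1.
Proof. by rewrite hull_ptE aff1E. Qed.

(** Evaluating a vanishing combination of the points at the constant function 1
    shows that its coefficients sum to 0, so it is also a combination of the
    vectors from [S ord0], which are independent by hypothesis; this disposes of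
    all coefficients but the first, and the sum disposes of that one. *)
Lemma referential_hull_free n (S : 'I_n.+1 -> A) (c : 'I_n.+1 -> R) :
  referential S -> \sum_i c i *: hull_pt (S i) = 0 -> forall i, c i = 0.
Proof.
move=> /free_famP hS hc.
have c_sum : \sum_i c i = 0.
  move/lfunP/(_ (aff1 A)): hc; rewrite sum_lfunE zero_lfunE => hc.
  rewrite -[RHS]hc; apply: eq_bigr => i _.
  by rewrite scale_lfunE hull_pt_aff1 [RHS]mulr1.
(* the coefficients have sum 0, hence the base point [S ord0] cancels *)
have c_vec : \sum_i c i *: vec (S ord0) (S i) = 0.
  apply: (@hull_vec_inj _ _ A); rewrite linear0 linear_sum /=.
  under eq_bigr => i _ do rewrite linearZ /= hull_vec_vec scalerBr.
  by rewrite sumrB hc -scaler_suml c_sum scale0r subr0.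
have c_lift : forall i, c (lift ord0 i) = 0.
  by apply: hS; move: c_vec; rewrite big_ord_recl vecPP scaler0 add0r.
move: c_sum; rewrite big_ord_recl big1 => [|i _]; last exact: c_lift.
rewrite addr0 => c0 i; case: (unliftP ord0 i) => [j|] -> //.
Qed.

End AffineLemmas.

Section CayleyMenger.
Variables (R : realType) (V : vectType R) (A : affineSpace V) (m : metric A).

Lemma CM_sym (v w : Aff (QuadM m)) : CM m v w = CM m w v.
Proof. by have [h _ _] := CMP m. Qed.

Lemma CM_Aff0 (v w : Aff (QuadM m)) : in_Aff0 v -> in_Aff0 w ->
  CM m v w = - hess m (d_m_vec v) (d_m_vec w).
Proof. by have [_ h _] := CMP m; exact: h. Qed.

Lemma CM_evalM P : CM m (evalM m P) = hull_pt (deltaM m P).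
Proof. by have [_ _ h] := CMP m. Qed.

Lemma CM_evalM2 P Q : CM m (evalM m P) (evalM m Q) = 2^-1 * sqdist m P Q.
Proof. by rewrite CM_evalM hull_ptE. Qed.

Lemma u_m_evalM P : u_m m (evalM m P) = 1.
Proof. by rewrite /u_m d_m_dualE /d_m lin_part_evalM hull_pt_aff1. Qed.

Lemma v_m_Aff0 : in_Aff0 (v_m m).
Proof. by rewrite /in_Aff0 /u_m d_m_dualE /d_m lin_part_aff1 zero_lfunE. Qed.

Lemma u_m_neq0 : u_m m != 0.
Proof.
apply/eqP => /(congr1 (fun z : 'Hom(Aff (QuadM m), R^o) => z (evalM m (origin A)))).
rewrite u_m_evalM zero_lfunE => e.
by have := oner_neq0 R; rewrite e eqxx.
Qed.

Lemma d_m_vec_v_m : d_m_vec (v_m m) = 0.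
Proof. by rewrite /d_m_vec /d_m lin_part_aff1 /vec_of_hull linear0. Qed.

(** This is not part of the characterization of [CM m], and is its only value
    on the basis [v_fam m S] that has to be computed. *)
Lemma CM_v_m : CM m (v_m m) = u_m m.
Proof.
apply/lfunP => v; pose v0 := evalM m (origin A).
have [v1 v1_0 ->] : exists2 v1, in_Aff0 v1 & v = u_m m v *: v0 + v1.
  exists (v - u_m m v *: v0); last by rewrite addrC subrK.
  by rewrite /in_Aff0 linearB linearZ /= u_m_evalM [_ *: _]mulr1 subrr.
move: (u_m m v) => k; rewrite !linearD !linearZ /= v1_0 u_m_evalM.
rewrite (CM_Aff0 v_m_Aff0 v1_0) d_m_vec_v_m linear0 zero_lfunE oppr0.
by rewrite CM_sym CM_evalM hull_pt_aff1.
Qed.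

Lemma evalM_sub_Aff0 P Q : in_Aff0 (evalM m Q - evalM m P).
Proof. by rewrite /in_Aff0 linearB /= !u_m_evalM subrr. Qed.

Lemma d_m_vec_evalM_sub P Q : d_m_vec (evalM m Q - evalM m P) = vec P Q.
Proof.
rewrite /d_m_vec /d_m linearB /= !lin_part_evalM -hull_vec_vec.
exact: hull_vecK.
Qed.

(** [CM m v] annihilates [v_m m], and the annihilator of the constants is the
    image of [d_m_dual].  The linear part of the resulting function is measured
    on the differences of evaluations, which represent all vectors of [A]. *)
Lemma CM_Aff0_affine (v : Aff (QuadM m)) : in_Aff0 v ->
  exists2 f : Aff A, CM m v = d_m_dual m f & lin_part f = - hess m (d_m_vec v).
Proof.
move=> v0; have [|f fE] := @hull_vec_onto _ _ (QuadM m) (CM m v).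
  by rewrite CM_sym CM_v_m.
exists f => //; apply: (@lin_part_uniq _ _ _ _ _ (origin A)) => x.
set O := origin A; set Q := shift O x.
have : CM m v (evalM m Q - evalM m O) = f Q - f O.
  rewrite fE hull_vecE [lin_part _]linearB /= !lin_part_evalM.
  by rewrite add_lfunE opp_lfunE !hull_ptE.
rewrite (CM_Aff0 v0 (evalM_sub_Aff0 _ _)) d_m_vec_evalM_sub vec_shift opp_lfunE.
by move=> ->; rewrite addrC subrK.
Qed.

(** If [CM m v = 0], pairing with [v_m m] puts [v] in Aff_0.  Its differential
    then lies in the nullspace of the hessian, so [v] is a multiple of [v_m m],
    whose image [u_m m] is nonzero. *)
Lemma CM_inj : nondegenerate_metric m -> lker (CM m) = 0%VS.
Proof.
move=> g0; apply/eqP/lker0P; apply: raddf_inj => v hv.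
have v0 : in_Aff0 v by rewrite /in_Aff0 -CM_v_m CM_sym hv zero_lfunE.
have [f fE gE] := CM_Aff0_affine v0.
have f0 : f = 0.
  by apply: (@hull_vec_inj _ _ (QuadM m)); rewrite linear0 -fE.
have dv0 : d_m_vec v = 0.
  have /lker0P g_inj : lker (hess m) == 0%VS by apply/eqP.
  by apply: g_inj; rewrite linear0 -[LHS]opprK -gE f0 linear0 oppr0.
have lv0 : lin_part v = 0 by rewrite -/(d_m v) -d_m_vecK // dv0 linear0.
move: hv; rewrite (lin_part_eq0 lv0) /= linearZ /= -/(v_m m) CM_v_m.
by move/eqP; rewrite scaler_eq0 (negPf u_m_neq0) orbF => /eqP ->; rewrite scale0r.
Qed.

Section Families.
Variable n : nat.
Implicit Types S T : 'I_n.+1 -> A.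

Lemma v_fam_lshift S i : v_fam m S (lshift 1 i) = evalM m (S i).
Proof. by rewrite /v_fam (unsplitK (inl i)). Qed.

Lemma v_fam_rshift S i : v_fam m S (rshift n.+1 i) = v_m m.
Proof. by rewrite /v_fam (unsplitK (inr i)). Qed.

(** Taking linear parts removes [v_m m] from a linear relation and leaves one
    between the points of the referential in the linear hull of [A]. *)
Lemma v_fam_basis S : \dim {: V} = n -> referential S -> is_basis (v_fam m S).
Proof.
move=> dV hS; apply: is_basis_free; first by rewrite !dim_Aff dV addn1.
apply/free_famP => c; rewrite big_split_ord /= big_ord1 v_fam_rshift.
under eq_bigr => i _ do rewrite v_fam_lshift.
move=> hc.
have c0 : forall i, c (lshift 1 i) = 0.
  apply: (referential_hull_free hS).
  move/(congr1 lin_part): hc; rewrite linear0 linearD linear_sum linearZ /=.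
  rewrite lin_part_aff1 scaler0 addr0 => hc; rewrite -[RHS]hc.
  by apply: eq_bigr => i _; rewrite linearZ /= lin_part_evalM.
move: hc; rewrite big1 => [|i _]; last by rewrite c0 scale0r.
rewrite add0r => /eqP; rewrite scaler_eq0 (negPf (aff1_neq0 _)) orbF => /eqP cm i.
by case: (split_ordP i) => j ->; [exact: c0 | rewrite ord1].
Qed.

Lemma CM_v_fam S i : CM m (v_fam m S i) = delta_fam m S i.
Proof.
by rewrite /v_fam /delta_fam; case: (fintype.split i) => j;
  [exact: CM_evalM | exact: CM_v_m].
Qed.

Lemma delta_fam_basis S : \dim {: V} = n -> nondegenerate_metric m ->
  referential S -> is_basis (delta_fam m S).
Proof.
move=> dV g0 hS; apply: is_basis_free; first by rewrite dim_dual !dim_Aff dV addn1.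
have k0 : ({: Aff (QuadM m)} :&: lker (CM m) = 0)%VS by rewrite CM_inj // capv0.
have /basis_free := limg_basis_of k0 (v_fam_basis dV hS).
by rewrite -map_comp (eq_map (CM_v_fam S)).
Qed.

Lemma form_mx_v_fam S T :
  form_mx (CM m) (v_fam m S) (v_fam m T) =
    block_mx (2^-1 *: D_mx m S T) (const_mx 1 : 'cV[R]_n.+1)
             (const_mx 1 : 'rV[R]_n.+1) 0.
Proof.
apply/matrixP => i j; case: (split_ordP i) => k ->; case: (split_ordP j) => l ->;
  rewrite ?block_mxEul ?block_mxEur ?block_mxEdl ?block_mxEdr !mxE;
  rewrite ?v_fam_lshift ?v_fam_rshift ?CM_evalM2 // CM_sym ?CM_v_m ?u_m_evalM //.
- by rewrite CM_sym CM_v_m u_m_evalM.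
- exact: v_m_Aff0.
Qed.

(** The square under [CM m] of [v = \sum_i (q - p)_i v_{S_i}] is computed twice:
    as minus the hessian form of its differential, and by bilinearity. *)
Lemma sqdist_bary S (P Q : A) (p q : 'cV[R]_n.+1) :
  bary_coord S P p -> bary_coord S Q q ->
  sqdist m P Q = - 2^-1 * ((q - p)^T *m D_mx m S S *m (q - p)) 0 0.
Proof.
move=> [p1 pE] [q1 qE]; pose c i := (q - p) i 0.
pose v := \sum_i c i *: evalM m (S i).
have dv : d_m v = hull_vec A (vec P Q).
  rewrite hull_vec_vec qE pE -sumrB /d_m linear_sum /=.
  by apply: eq_bigr => i _; rewrite linearZ /= lin_part_evalM -scalerBl /c !mxE.
have v0 : in_Aff0 v by rewrite /in_Aff0 /u_m d_m_dualE dv hull_vec1.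
have dvE : d_m_vec v = vec P Q by rewrite /d_m_vec dv hull_vecK.
have := CM_Aff0 v0 v0; rewrite dvE -/(sqdist m P Q) => /(congr1 -%R).
rewrite opprK => <-; rewrite mulNr; congr (- _).
rewrite {2}/v linear_sum /= mxE mulr_sumr; apply: eq_bigr => j _.
rewrite linearZ /= /v linear_sum sum_lfunE mxE [LHS]mulrC mulrA mulr_sumr.
congr (_ * _); apply: eq_bigr => i _.
by rewrite linearZ scale_lfunE /= CM_evalM2 /c !mxE mulrCA.
Qed.

End Families.
End CayleyMenger.

Theorem proposition5p13 (R : realType) (V : vectType R) (A : affineSpace V)
    (n : nat) (hn : \dim {: V} = n) (m : metric A) :
  [/\ forall v : Aff (QuadM m), in_Aff0 v ->
        exists2 f : Aff A,
          CM m v = d_m_dual m f & lin_part f = - hess m (d_m_vec v),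
      forall S : 'I_n.+1 -> A, referential S ->
        [/\ is_basis (v_fam m S),
            forall i, CM m (v_fam m S i) = delta_fam m S i
          & nondegenerate_metric m -> is_basis (delta_fam m S)],
      forall S T : 'I_n.+1 -> A, referential S -> referential T ->
        form_mx (CM m) (v_fam m S) (v_fam m T) =
          block_mx (2^-1 *: D_mx m S T) (const_mx 1 : 'cV[R]_n.+1)
                   (const_mx 1 : 'rV[R]_n.+1) 0,
      forall S : 'I_n.+1 -> A, referential S ->
        form_mx (CM m) (v_fam m S) (v_fam m S) =
          block_mx (2^-1 *: D_mx m S S) (const_mx 1 : 'cV[R]_n.+1)
                   (const_mx 1 : 'rV[R]_n.+1) 0
    & forall S : 'I_n.+1 -> A, referential S ->
        forall (P Q : A) (p q : 'cV[R]_n.+1),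
          bary_coord S P p -> bary_coord S Q q ->
          sqdist m P Q =
            - 2^-1 * ((q - p)^T *m D_mx m S S *m (q - p)) 0 0].
Proof.
split.
- exact: CM_Aff0_affine.
- move=> S hS; split; [exact: v_fam_basis | exact: CM_v_fam |].
  by move=> g0; exact: delta_fam_basis.
- by move=> S T _ _; exact: form_mx_v_fam.
- by move=> S _; exact: form_mx_v_fam.
- by move=> S _ P Q p q; exact: sqdist_bary.
Qed.
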